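(* The global flux quadrature divergence operator $$\mathrm{DIV}\,\mathbf v=(D_x\otimes D_yI_y)u+(D_xI_x\otimes D_y)v=(D_x\otimes D_y)(U+V)$$ vanishes identically for all $u,v$ such that $$U_{i,k;j,s}+V_{i,k;j,s}=f(i,k)+g(j,s)$$ for some functions $f$ (of the $x$-node index only) and $g$ (of the $y$-node index only).
   Context: Grid and spaces: $K\ge1$; $\Omega^x=\bigcup_{i=0}^{N_x-1}E^x_i$ with $E_i^x=[x_i,x_{i+1}]$ of equal length $\Delta x$, $\Omega^y=\bigcup_{j=0}^{N_y-1}E^y_j$ with $E_j^y=[y_j,y_{j+1}]$ of equal length $\Delta y$. With the Gauss–Lobatto points $0=\xi_0<\dots<\xi_K=1$ of $[0,1]$, set $x_{i,p}=x_i+\xi_p\Delta x$, $y_{j,p}=y_j+\xi_p\Delta y$ (so $x_{i,K}=x_{i+1,0}$, and the index pairs $(i,K)$ and $(i+1,0)$ denote the same node), numbered globally as $x_\alpha=x_{i,p}$, $\alpha=iK+p$, $0\le\alpha\le N_xK$, and similarly $y_\beta$. A grid function $q=(q_{\alpha;\beta})$ (also written $q_{i,k;j,s}$) is identified with $q_h=\sum q_{\alpha;\beta}\varphi^x_\alpha(x)\varphi^y_\beta(y)$, where $\varphi^x_\alpha$ is continuous, of degree $\le K$ on each cell, with $\varphi^x_\alpha(x_{\alpha'})=\delta_{\alpha\alpha'}$ (same in $y$). Operators: $(D_x)_{\alpha\alpha'}=\int_{\Omega^x}\varphi^x_\alpha\partial_x\varphi^x_{\alpha'}dx$, $D_y$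 likewise; $((A\otimes B)q)_{\alpha;\beta}=\sum_{\alpha',\beta'}A_{\alpha\alpha'}B_{\beta\beta'}q_{\alpha';\beta'}$. The integrator is $(I_xw)_\alpha=\int_{x_0}^{x_\alpha}w_h\,dx$ with $w_h=\sum_{\alpha'} w_{\alpha'}\varphi^x_{\alpha'}$, similarly $I_y$; $U=(\mathrm{Id}\otimes I_y)u$, $V=(I_x\otimes\mathrm{Id})v$. *)

(* Defs.v *)
From HB Require Import structures.
From mathcomp Require Import all_boot all_order all_algebra.
From mathcomp Require Import all_classical all_reals all_analysis.
Set Implicit Arguments.
Unset Strict Implicit.
Unset Printing Implicit Defensive.
Import Order.TTheory GRing.Theory Num.Theory.
Import numFieldNormedType.Exports.
Local Open Scope classical_set_scope.
Local Open Scope ring_scope.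

(* Rodrigues' formula. *)
Definition legendre (R : realType) (n : nat) : {poly R} :=
  (2 ^+ n * n`!%:R)^-1 *: (('X ^+ 2 - 1) ^+ n)^`(n).

(* The K+1 Gauss-Lobatto points of [0,1]: the two end points and, after the
   affine change of variable t |-> 2t-1 onto [-1,1], the zeros of P_K'. *)
Definition gauss_lobatto (R : realType) (K : nat) (xi : 'I_K.+1 -> R) : Prop :=
  [/\ xi ord0 = 0,
      xi ord_max = 1,
      {homo xi : p q / (p < q)%N >-> p < q} &
      forall p : 'I_K.+1, (0 < p < K)%N ->
        root (legendre R K)^`() (2 * xi p - 1)].

Lemma node_idx_subproof (K N : nat) (i : 'I_N) (p : 'I_K.+1) :
  (i * K + p < (N * K).+1)%N.
Proof.
rewrite ltnS (@leq_trans (i * K + K)%N) //; first by rewrite leq_add2l -ltnS.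
by rewrite addnC -mulSn leq_mul2r ltn_ord orbT.
Qed.

(* The pairs (i, K) and (i+1, 0) get the same global number. *)
Definition node_idx (K N : nat) (i : 'I_N) (p : 'I_K.+1) : 'I_(N * K).+1 :=
  Ordinal (node_idx_subproof i p).

Definition edge (R : realType) (x0 h : R) (i : nat) : R := x0 + i%:R * h.

(* The last global number N * K decomposes as (N, 0), i.e. the right end point
   of the grid; see node_coordE. *)
Definition node_coord (R : realType) (K : nat) (xi : 'I_K.+1 -> R) (x0 h : R)
    (al : nat) : R :=
  edge x0 h (al %/ K) + xi (inord (al %% K)) * h.

Lemma node_coordE (R : realType) (K N : nat) (xi : 'I_K.+1 -> R) (x0 h : R)
    (i : 'I_N) (p : 'I_K.+1) : (0 < K)%N -> gauss_lobatto xi ->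
  node_coord xi x0 h (node_idx i p) = edge x0 h i + xi p * h.
Proof.
move=> K_gt0 [xi0 xiK _ _]; rewrite /node_coord /=.
have := ltn_ord p; rewrite ltnS leq_eqVlt => /orP[/eqP pK|ltpK].
  have -> : p = ord_max by apply: val_inj.
  rewrite /= addnC -mulSn modnMl mulnK //.
  rewrite (_ : inord 0 = ord0) ?xi0 ?xiK; last by apply: val_inj; rewrite /= inordK.
  by rewrite /edge -[i.+1]addn1 natrD mulrDl addrA !mul1r mul0r addr0.
by rewrite divnMDl // divn_small // addn0 modnMDl modn_small // inord_val.
Qed.

(* No condition is imposed outside the grid [x0, x0 + N h]. *)
Definition nodal_basis (R : realType) (K N : nat) (xi : 'I_K.+1 -> R)
    (x0 h : R) (phi : 'I_(N * K).+1 -> R -> R) : Prop :=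
  forall al : 'I_(N * K).+1,
  [/\ {within `[edge x0 h 0, edge x0 h N], continuous (phi al)},
      forall i : 'I_N, exists2 P : {poly R}, (size P <= K.+1)%N &
        forall x, x \in `[edge x0 h i, edge x0 h i.+1] -> phi al x = P.[x] &
      forall al' : 'I_(N * K).+1,
        phi al (node_coord xi x0 h al') = (al == al')%:R].

(* The integrand is not differentiable at the (finitely many) cell interfaces;
   the value that derive1 takes there is irrelevant to the integral. *)
Definition diff_mx (R : realType) (K N : nat) (x0 h : R)
    (phi : 'I_(N * K).+1 -> R -> R) : 'M[R]_((N * K).+1) :=
  \matrix_(al, al')
    (\int[lebesgue_measure]_(x in `[edge x0 h 0, edge x0 h N])
       (phi al x * derive1 (phi al') x))%R.

Definition interp (R : realType) (n : nat) (phi : 'I_n -> R -> R)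
    (w : 'cV[R]_n) (x : R) : R := \sum_al w al ord0 * phi al x.

Definition integrator (R : realType) (K N : nat) (xi : 'I_K.+1 -> R) (x0 h : R)
    (phi : 'I_(N * K).+1 -> R -> R) (w : 'cV[R]_((N * K).+1)) :
    'cV[R]_((N * K).+1) :=
  \col_al
    (\int[lebesgue_measure]_(x in `[x0, node_coord xi x0 h al])
       interp phi w x)%R.

(* The matrix of the linear map integrator; see int_mxE. *)
Definition int_mx (R : realType) (K N : nat) (xi : 'I_K.+1 -> R) (x0 h : R)
    (phi : 'I_(N * K).+1 -> R -> R) : 'M[R]_((N * K).+1) :=
  \matrix_(al, al') integrator xi x0 h phi (delta_mx al' ord0) al ord0.

Definition tens (R : realType) (m n : nat) (A : 'M[R]_m) (B : 'M[R]_n)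
    (q : 'M[R]_(m, n)) : 'M[R]_(m, n) :=
  \matrix_(al, be) \sum_al' \sum_be' A al al' * B be be' * q al' be'.

Definition gf_potential (R : realType) (m n : nat) (Ix : 'M[R]_m)
    (Iy : 'M[R]_n) (u v : 'M[R]_(m, n)) : 'M[R]_(m, n) :=
  tens 1%:M Iy u + tens Ix 1%:M v.

Definition gf_div (R : realType) (m n : nat) (Dx Ix : 'M[R]_m)
    (Dy Iy : 'M[R]_n) (u v : 'M[R]_(m, n)) : 'M[R]_(m, n) :=
  tens Dx (Dy *m Iy) u + tens (Dx *m Ix) Dy v.

Lemma edge_node_le (R : realType) (K N : nat) (xi : 'I_K.+1 -> R) (x0 h : R)
    (al : 'I_(N * K).+1) : (0 < K)%N -> 0 < h -> gauss_lobatto xi ->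
  node_coord xi x0 h al <= edge x0 h N.
Proof.
move=> K_gt0 h_gt0 [xi0 xiK xi_lt _].
have xi_le1 p : xi p <= 1.
  have := ltn_ord p; rewrite ltnS leq_eqVlt => /orP[/eqP pK|ltpK].
    by rewrite (_ : p = ord_max) ?xiK //; apply: val_inj.
  by rewrite -xiK; apply/ltW/xi_lt.
rewrite /node_coord /edge -addrA lerD2l -mulrDl ler_pM2r //.
have := leq_ord al; rewrite leq_eqVlt => /orP[/eqP ->|lt_al].
  rewrite mulnK // modnMl (_ : inord 0 = ord0) ?xi0 ?addr0 //.
  by apply: val_inj; rewrite /= inordK.
have : (al %/ K < N)%N by rewrite ltn_divLR.
rewrite -(ler_nat R) => /(le_trans _); apply.
by rewrite -[in leRHS]addn1 natrD lerD2l.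
Qed.

Lemma int_mxE (R : realType) (K N : nat) (xi : 'I_K.+1 -> R) (x0 h : R)
    (phi : 'I_(N * K).+1 -> R -> R) (w : 'cV[R]_((N * K).+1)) :
  (0 < K)%N -> 0 < h -> gauss_lobatto xi -> nodal_basis xi x0 h phi ->
  int_mx xi x0 h phi *m w = integrator xi x0 h phi w.
Proof.
move=> K_gt0 h_gt0 xiGL phiB; apply/colP => al; rewrite !mxE.
set D := `[x0, _]%classic.
have phi_int a : lebesgue_measure.-integrable D (EFin \o phi a).
  apply: continuous_compact_integrable; first exact: segment_compact.
  have [phiC _ _] := phiB a.
  apply: continuous_subspaceW phiC; apply: subset_itv.
    by rewrite bnd_simp /edge mul0r addr0.
  by rewrite bnd_simp; apply: edge_node_le.
have sum_int (s : seq 'I_(N * K).+1) :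
    lebesgue_measure.-integrable D
      (EFin \o (fun x => \sum_(a <- s) w a ord0 * phi a x)) /\
    (\int[lebesgue_measure]_(x in D) (\sum_(a <- s) w a ord0 * phi a x))%R =
    \sum_(a <- s) w a ord0 * (\int[lebesgue_measure]_(x in D) phi a x)%R.
  have mD : @measurable _ (measurableTypeR R) D by exact: measurable_itv.
  elim: s => [|a s [IHi IHe]].
    rewrite big_nil; split.
      apply: (eq_integrable mD (cst 0%E)); last exact: integrable0.
      by move=> x _ /=; rewrite big_nil.
    under eq_Rintegral do rewrite big_nil.
    by rewrite Rintegral_cst // mul0r.
  have ai : lebesgue_measure.-integrable D (EFin \o (fun x => w a ord0 * phi a x)).
    by apply: eq_integrable (integrableZl mD (w a ord0) (phi_int a)).
  rewrite big_cons -IHe -RintegralZl // -RintegralD //; split.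
    apply: eq_integrable (integrableD mD ai IHi) => //= x _.
    by rewrite big_cons EFinD.
  by apply: eq_Rintegral => x _; rewrite big_cons.
rewrite /interp (sum_int _).2; apply: eq_bigr => a _; rewrite !mxE mulrC.
congr (_ * _); apply: eq_Rintegral => x _; rewrite /interp (bigD1 a) //=.
rewrite mxE !eqxx mul1r big1 ?addr0 // => b /negPf ba.
by rewrite mxE ba mul0r.
Qed.

(* Main.v *)
Require Import Defs.
From HB Require Import structures.
From mathcomp Require Import all_boot all_order all_algebra.
From mathcomp Require Import all_classical all_reals all_analysis.
From mathcomp Require Import measurable_realfun ring.
Set Implicit Arguments.
Unset Strict Implicit.
Unset Printing Implicit Defensive.
Import Order.TTheory GRing.Theory Num.Theory.
Import numFieldNormedType.Exports.
Local Open Scope classical_set_scope.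
Local Open Scope ring_scope.


(** The derivative of a constant is zero, and the matrix [D] of the weak
    derivative inherits this: its rows sum to zero. Indeed the nodal functions
    of each cell add up to a polynomial of degree at most [K] that equals 1 at
    the [K+1] distinct nodes of the cell, hence to 1 ([cell_polys]), so their
    derivatives add up to 0 inside each cell, and the finitely many interfaces
    have measure zero ([diff_mx_const]).

    A potential [U + V] of the form [f + g] is, as a matrix, the sum of
    [a *m 1^T], which is constant in [y], and [1 *m b], which is constant in
    [x]. As [Dx (x) Dy] acts by [q |-> Dx *m q *m Dy^T] ([tensE]), [Dy] kills
    the first term and [Dx] the second ([tens_split_eq0]). The same formula for
    the tensor action makes it multiplicative in each factor, which gives the
    factorization of the divergence through the potential
    ([gf_div_potential]). *)

(** * Tensor products of matrices acting on grid functions *)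

Lemma tensE (R : realType) (m n : nat) (A : 'M[R]_m) (B : 'M[R]_n)
    (q : 'M[R]_(m, n)) : tens A B q = A *m q *m B^T.
Proof.
apply/matrixP => al be; rewrite !mxE exchange_big /=.
apply: eq_bigr => be' _; rewrite !mxE mulr_suml; apply: eq_bigr => al' _.
by rewrite mulrAC.
Qed.

Lemma gf_div_potential (R : realType) (m n : nat) (Dx Ix : 'M[R]_m)
    (Dy Iy : 'M[R]_n) (u v : 'M[R]_(m, n)) :
  gf_div Dx Ix Dy Iy u v = tens Dx Dy (gf_potential Ix Iy u v).
Proof.
rewrite /gf_div /gf_potential !tensE trmx1 mul1mx mulmx1 trmx_mul.
by rewrite mulmxDr mulmxDl !mulmxA.
Qed.

Lemma tens_split_eq0 (R : realType) (m n : nat) (A : 'M[R]_m) (B : 'M[R]_n)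
    (a : 'cV[R]_m) (b : 'rV[R]_n) :
  A *m const_mx 1 = 0 :> 'cV_m -> B *m const_mx 1 = 0 :> 'cV_n ->
  tens A B (a *m const_mx 1 + const_mx 1 *m b) = 0.
Proof.
move=> A1 B1; rewrite tensE mulmxDr mulmxDl.
rewrite [A *m (const_mx 1 *m b)]mulmxA A1 !mul0mx addr0.
by rewrite -!mulmxA -[const_mx 1]trmx_const -trmx_mul B1 trmx0 !mulmx0.
Qed.

(** * Integration cell by cell *)

Lemma integrable_setU d (T : measurableType d) (R : realType)
    (mu : {measure set T -> \bar R}) (A B : set T) (f : T -> \bar R) :
  measurable A -> measurable B -> [disjoint A & B] ->
  mu.-integrable A f -> mu.-integrable B f -> mu.-integrable (A `|` B) f.
Proof.
move=> mA mB AB /integrableP[mfA iA] /integrableP[mfB iB].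
have mfU := (measurable_funU f mA mB).2 (conj mfA mfB).
apply/integrableP; split=> //.
rewrite ge0_integral_setU //; first exact: lte_add_pinfty.
exact: measurableT_comp.
Qed.

Lemma integrable_set1 (R : realType) (f : R -> \bar R) (r : R) :
  lebesgue_measure.-integrable [set r] f.
Proof.
apply: null_set_integrable => //; first exact: measurable_fun_set1.
exact: lebesgue_measure_set1.
Qed.

Lemma Rintegral_sum d (T : measurableType d) (R : realType)
    (mu : {measure set T -> \bar R}) (D : set T) (I : Type) (s : seq I)
    (f : I -> T -> R) :
  measurable D -> (forall i, mu.-integrable D (EFin \o f i)) ->
  (\int[mu]_(x in D) (\sum_(i <- s) f i x))%R =
  \sum_(i <- s) (\int[mu]_(x in D) f i x)%R.
Proof.
move=> mD fi; rewrite /Rintegral.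
under eq_integral do rewrite -sumEFin.
rewrite (integral_sum mD fi) -sum_fine // => i _.
exact: integrable_fin_num.
Qed.

(** Only the open cells matter: [f] may take any values at the interfaces,
    such as those that the derivative takes at a kink of a nodal function. *)
Lemma integral_cells (R : realType) (e : nat -> R) (n : nat) (f : R -> R) :
  (forall i, e i < e i.+1) ->
  (forall i, (i < n)%N ->
     lebesgue_measure.-integrable `]e i, e i.+1[%classic (EFin \o f)) ->
  lebesgue_measure.-integrable `[e 0, e n]%classic (EFin \o f) /\
  (\int[lebesgue_measure]_(x in `[e 0, e n]) f x)%R =
  \sum_(i < n) (\int[lebesgue_measure]_(x in `]e i, e i.+1[) f x)%R.
Proof.
move=> e_lt; elim: n => [|n IHn] fi.
  rewrite set_itv1 big_ord0 Rintegral_set1; split=> //; exact: integrable_set1.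
have [i_n eq_n] := IHn (fun i lt_in => fi i (ltnW lt_in)).
have e_le : e 0 <= e n.
  by elim: (n) => // k /le_trans; apply; apply/ltW/e_lt.
have -> : `[e 0, e n.+1]%classic =
    `[e 0, e n]%classic `|` `]e n, e n.+1]%classic.
  by rewrite -itv_bndbnd_setU // bnd_simp // ltW.
have mI (i : interval R) : @measurable _ (measurableTypeR R) [set` i].
  exact: measurable_itv.
have disj : [disjoint `[e 0, e n]%classic & `]e n, e n.+1]%classic].
  apply/disj_setPS => x [] /=; rewrite !in_itv /= => /andP[_ x_le] /andP[lt_x _].
  by move: (le_lt_trans x_le lt_x); rewrite ltxx.
have i_cell := fi n (ltnSn n).
have i_Sn : lebesgue_measure.-integrable `]e n, e n.+1]%classic (EFin \o f).
  rewrite -(@setUitv1 _ _ _ _ true) ?bnd_simp //; apply: integrable_setU => //.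
  - apply/disj_setPS => x [] /= + xe; rewrite xe in_itv /= ltxx andbF //.
  - exact: integrable_set1.
have i_U := integrable_setU (mI _) (mI _) disj i_n i_Sn.
split=> //; rewrite Rintegral_setU // eq_n big_ord_recr /=; congr (_ + _).
by rewrite -Rintegral_itv_bndo_bndc.
Qed.

Lemma integrable_poly_on (R : realType) (P : {poly R}) (a b : R) (f : R -> R) :
  {in `]a, b[, f =1 horner P} ->
  lebesgue_measure.-integrable `]a, b[%classic (EFin \o f).
Proof.
have mI (i : interval R) : @measurable _ (measurableTypeR R) [set` i].
  exact: measurable_itv.
move=> fP; apply: (eq_integrable (mI _) (EFin \o horner P)).
  by move=> x; rewrite inE /= => /fP ->.
apply: (integrableS (mI `[a, b]) (mI _)).
  exact: subset_itv_oo_cc.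
apply: continuous_compact_integrable; first exact: segment_compact.
exact/continuous_subspaceT/continuous_horner.
Qed.

Lemma derive1_poly_on (R : realType) (P : {poly R}) (a b : R) (f : R -> R) :
  {in `]a, b[, f =1 horner P} -> {in `]a, b[, derive1 f =1 horner P^`()}.
Proof.
move=> fP x xab; rewrite derivE !derive1E; apply: near_eq_derive.
by near do apply: fP; exact: near_in_itvoo.
Unshelve. all: by end_near. Qed.

(** * Grid functions that split into a part in x and a part in y *)

Lemma node_idx_surj (K N : nat) (al : 'I_(N * K).+1) :
  (0 < K)%N -> (0 < N)%N ->
  exists (i : 'I_N) (k : 'I_K.+1), al = node_idx i k.
Proof.
move=> K_gt0 N_gt0; have := leq_ord al; rewrite leq_eqVlt => /orP[/eqP al_max|lt_al].
  have lt_N : (N.-1 < N)%N by rewrite prednK.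
  exists (Ordinal lt_N), ord_max; apply: val_inj => /=.
  by rewrite al_max -[in LHS](prednK N_gt0) mulSn addnC.
have lt_q : (al %/ K < N)%N by rewrite ltn_divLR.
have lt_r : (al %% K < K.+1)%N by rewrite ltnS ltnW // ltn_mod.
by exists (Ordinal lt_q), (Ordinal lt_r); apply: val_inj; rewrite /= -divn_eq.
Qed.

(** A splitting over pairs (cell, local index) may look weaker than one over
    global numbers, since [f] could take two values at an interface node. But
    subtracting the values of [Q] along one row and one column eliminates [f]
    and [g]: [Q al be = Q al 0 + Q 0 be - Q 0 0]. *)
Lemma split_on_nodes (R : realType) (K Nx Ny : nat)
    (Q : 'M[R]_((Nx * K).+1, (Ny * K).+1)) (f : 'I_Nx -> 'I_K.+1 -> R)
    (g : 'I_Ny -> 'I_K.+1 -> R) :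
  (0 < K)%N -> (0 < Nx)%N -> (0 < Ny)%N ->
  (forall i k j s, Q (node_idx i k) (node_idx j s) = f i k + g j s) ->
  exists (a : 'cV[R]_(Nx * K).+1) (b : 'rV[R]_(Ny * K).+1),
    Q = a *m const_mx 1 + const_mx 1 *m b.
Proof.
move=> K_gt0 Nx_gt0 Ny_gt0 Qfg.
exists (col ord0 Q), (row ord0 Q - const_mx (Q ord0 ord0)).
apply/matrixP => al be; rewrite !mxE !big_ord1 !mxE mul1r mulr1.
have [i0 [k0 node0]] := node_idx_surj (ord0 : 'I_(Nx * K).+1) K_gt0 Nx_gt0.
have [j0 [s0 node0']] := node_idx_surj (ord0 : 'I_(Ny * K).+1) K_gt0 Ny_gt0.
have [i [k ->]] := node_idx_surj al K_gt0 Nx_gt0.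
have [j [s ->]] := node_idx_surj be K_gt0 Ny_gt0.
by rewrite node0 node0' !Qfg; ring.
Qed.

(** * The derivative matrix kills constants *)

Section OneDimension.
Variables (R : realType) (K N : nat) (xi : 'I_K.+1 -> R) (x0 h : R).
Variable phi : 'I_(N * K).+1 -> R -> R.
Hypotheses (K_gt0 : (0 < K)%N) (h_gt0 : 0 < h).
Hypotheses (xiGL : gauss_lobatto xi) (phiB : nodal_basis xi x0 h phi).

Lemma edge_lt (i : nat) : edge x0 h i < edge x0 h i.+1.
Proof. by rewrite ltrD2l ltr_pM2r // ltr_nat. Qed.

Lemma gauss_lobatto_ge0_le1 (p : 'I_K.+1) : 0 <= xi p <= 1.
Proof.
have [<- <- xi_lt _] := xiGL; apply/andP; split.
  have [/eqP p0|p_gt0] := posnP p; last exact/ltW/xi_lt.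
  by rewrite (_ : p = ord0) //; apply/eqP.
have := leq_ord p; rewrite leq_eqVlt => /orP[/eqP pK|ltpK].
  by rewrite (_ : p = ord_max) //; apply: val_inj.
exact/ltW/xi_lt.
Qed.

Lemma gauss_lobatto_inj : injective xi.
Proof.
have [_ _ xi_lt _] := xiGL; move=> p q xi_pq; apply: val_inj.
by case: (ltngtP p q) => // /xi_lt; rewrite xi_pq ltxx.
Qed.

Lemma node_in_cell (i : 'I_N) (p : 'I_K.+1) :
  edge x0 h i + xi p * h \in `[edge x0 h i, edge x0 h i.+1].
Proof.
have /andP[xi_ge0 xi_le1] := gauss_lobatto_ge0_le1 p.
have h_ge0 := ltW h_gt0; rewrite in_itv /= lerDl mulr_ge0 //= /edge.
by rewrite -addrA lerD2l -natr1 mulrDl lerD2l ler_wpM2r.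
Qed.

(** The nodal functions form a partition of unity on each cell: their sum minus
    1 has size at most [K+1] and vanishes at the [K+1] nodes of the cell. *)
Lemma cell_polys (i : 'I_N) :
  exists2 P : 'I_(N * K).+1 -> {poly R},
    forall al, {in `[edge x0 h i, edge x0 h i.+1], phi al =1 horner (P al)} &
    \sum_al P al = 1.
Proof.
have /choice[P PE] : forall al, exists P : {poly R}, (size P <= K.+1)%N /\
    {in `[edge x0 h i, edge x0 h i.+1], phi al =1 horner P}.
  by move=> al; have [_ /(_ i)[P sP PE] _] := phiB al; exists P.
exists P => [al|]; first by have [] := PE al.
apply/eqP; rewrite -subr_eq0; apply/negPn/negP => S_neq0.
pose nodes := [seq edge x0 h i + xi p * h | p <- enum 'I_K.+1].
have nodes_uniq : uniq nodes.
  rewrite map_inj_uniq ?enum_uniq // => p q /addrI /(mulIf (lt0r_neq0 h_gt0)).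
  exact: gauss_lobatto_inj.
have nodes_root : all (root (\sum_al P al - 1)) nodes.
  apply/allP => _ /mapP[p _ ->]; rewrite /root hornerD hornerN hornerC horner_sum.
  rewrite (eq_bigr (fun al => (al == node_idx i p)%:R)) => [|al _].
    rewrite (bigD1 (node_idx i p)) //= eqxx big1 ?addr0 ?subrr //.
    by move=> al /negPf ->.
  have [_ /(_ _ (node_in_cell i p)) <-] := PE al.
  by have [_ _ <-] := phiB al; rewrite (node_coordE _ _ _ _ K_gt0 xiGL).
have := max_poly_roots S_neq0 nodes_root nodes_uniq.
rewrite size_map size_enum_ord ltnNge => /negP; apply.
apply: leq_trans (size_polyD _ _) _; rewrite size_polyN size_poly1 geq_max andbT.
apply: leq_trans (size_sum _ _ _) _; apply/bigmax_leqP => al _.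
by have [] := PE al.
Qed.

(** Inside a cell the nodal functions are polynomials, so the integrands of a
    row are integrable there and their sum is [phi al] times the derivative of
    the constant 1. *)
Lemma diff_mx_const : diff_mx x0 h phi *m const_mx 1 = 0 :> 'cV_(N * K).+1.
Proof.
apply/colP => al; rewrite !mxE.
pose F al' x := phi al x * derive1 (phi al') x.
have F_int al' i : (i < N)%N -> lebesgue_measure.-integrable
    `]edge x0 h i, edge x0 h i.+1[%classic (EFin \o F al').
  move=> lt_iN; have [P PE _] := cell_polys (Ordinal lt_iN).
  have oP be : {in `]edge x0 h i, edge x0 h i.+1[, phi be =1 horner (P be)}.
    by move=> x /subset_itv_oo_cc /PE.
  apply: (@integrable_poly_on _ (P al * (P al')^`())) => x xi_in.
  by rewrite hornerM -oP // -(derive1_poly_on (oP al')).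
under eq_bigr => al' _.
  rewrite !mxE mulr1 (integral_cells edge_lt (F_int al')).2.
  over.
rewrite exchange_big big1 // => i _ /=.
rewrite -Rintegral_sum //; last by move=> al'; exact: F_int.
have [P PE sumP] := cell_polys i.
rewrite (@eq_Rintegral _ _ _ _ _ (cst 0)) ?Rintegral_cst ?mul0r //.
move=> x; rewrite inE /= => x_in; rewrite -mulr_sumr.
rewrite (eq_bigr (fun be => (P be)^`().[x])) => [|be _].
  by rewrite -horner_sum -raddf_sum sumP /= derivC horner0 mulr0.
apply: derive1_poly_on x_in => y /subset_itv_oo_cc; exact: PE.
Qed.

End OneDimension.

Theorem proposition4p1 (R : realType) (K Nx Ny : nat) (xi : 'I_K.+1 -> R)
    (x0 y0 dx dy : R)
    (phix : 'I_(Nx * K).+1 -> R -> R) (phiy : 'I_(Ny * K).+1 -> R -> R)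
    (K_ge1 : (1 <= K)%N) (Nx_ge1 : (1 <= Nx)%N) (Ny_ge1 : (1 <= Ny)%N)
    (dx_gt0 : 0 < dx) (dy_gt0 : 0 < dy)
    (xiGL : gauss_lobatto xi)
    (phixB : nodal_basis xi x0 dx phix) (phiyB : nodal_basis xi y0 dy phiy) :
  let Dx := diff_mx x0 dx phix in
  let Dy := diff_mx y0 dy phiy in
  let Ix := int_mx xi x0 dx phix in
  let Iy := int_mx xi y0 dy phiy in
  (forall u v : 'M[R]_((Nx * K).+1, (Ny * K).+1),
     gf_div Dx Ix Dy Iy u v = tens Dx Dy (gf_potential Ix Iy u v)) /\
  (forall u v : 'M[R]_((Nx * K).+1, (Ny * K).+1),
     (exists (f : 'I_Nx -> 'I_K.+1 -> R) (g : 'I_Ny -> 'I_K.+1 -> R),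
        forall (i : 'I_Nx) (k : 'I_K.+1) (j : 'I_Ny) (s : 'I_K.+1),
          gf_potential Ix Iy u v (node_idx i k) (node_idx j s) =
          f i k + g j s) ->
     gf_div Dx Ix Dy Iy u v = 0).
Proof.
move=> Dx Dy Ix Iy; split=> u v; first exact: gf_div_potential.
move=> [f [g Qfg]]; rewrite gf_div_potential.
have [a [b ->]] := split_on_nodes K_ge1 Nx_ge1 Ny_ge1 Qfg.
by apply: tens_split_eq0; [apply: (diff_mx_const K_ge1 dx_gt0 xiGL phixB)
                          |apply: (diff_mx_const K_ge1 dy_gt0 xiGL phiyB)].
Qed.
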